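(* Let $(G,d)$ be a compact metric space and suppose that $T_i:G\to G$ is paracontractive for every $i\in I$. Assume $C\neq\emptyset$. Then the sequence $(X_k)_{k\in\mathbb{N}_0}$ of random variables generated by $X_0\sim\mu$, $X_{k+1}=T_{\xi_k}X_k$, converges almost surely to a random variable $X_\mu\in C$ (depending on the initial distribution $\mu$).
   Context: Setting: $(G,d)$ is a metric space with Borel $\sigma$-algebra $\mathcal{B}(G)$; $(I,\mathcal{I})$ is a measurable space; $(T_i)_{i\in I}$ is a family of continuous maps $T_i:G\to G$ such that $\Phi:G\times I\to G$, $\Phi(x,i)=T_ix$, is measurable. $(\Omega,\mathcal{F},\mathbb{P})$ is a probability space, $\xi:\Omega\to I$ is measurable, and $(\xi_k)_{k\in\mathbb{N}_0}$ are i.i.d. with the same distribution as $\xi$. $\mu$ is a probability measure on $(G,\mathcal{B}(G))$, $X_0$ is a $G$-valued random variable with law $\mu$, and $X_0,\xi_0,\dots,\xi_k$ are independent for every $k\in\mathbb{N}_0$. The random function iteration is $X_{k+1}=T_{\xi_k}X_k$, $k\in\mathbb{N}_0$. $\operatorname{Fix}T_i=\{x\in G: T_ix=x\}$ and $C:=\{x\in G:\mathbb{P}(x\in\operatorname{Fix}T_\xi)=1\}$; the standing assumption is $C\ne\emptyset$. $T_i$ is paracontractive (a paracontraction) if it is continuous and $d(T_ix,y)<d(x,y)$ for all $x\notin\operatorname{Fix}T_i$ and all $y\in\operatorname{Fix}T_i$. *)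

(* Defs.v *)
From HB Require Import structures.
From mathcomp Require Import all_boot all_order all_algebra finmap.
From mathcomp Require Import all_classical all_reals all_analysis.

Set Implicit Arguments.
Unset Strict Implicit.
Unset Printing Implicit Defensive.

Import Order.TTheory GRing.Theory Num.Theory.
Import numFieldNormedType.Exports.

Local Open Scope classical_set_scope.
Local Open Scope ring_scope.

(* Nothing in this structure relates the metric to the sigma-algebra: that the
   measurable sets are the Borel sets is stated separately, by [is_borel]. *)
#[short(type="measurableMetricType")]
HB.structure Definition MeasurableMetric (d : measure_display)
    (K : numDomainType) :=
  { M of Metric K M & Measurable d M }.

Definition is_borel (d : measure_display) (R : realType)
    (G : measurableMetricType d R) : Prop :=
  @measurable d G = <<s [set U : set G | open U] >>.

Definition Fix (T : Type) (f : T -> T) : set T := [set x | f x = x].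

Definition paracontractive (R : realType) (G : metricType R) (f : G -> G)
    : Prop :=
  continuous f /\
  (forall x y : G, ~ Fix f x -> Fix f y -> mdist (f x) y < mdist x y).

(* Mutual independence of a family of systems of events, indexed by an
   arbitrary (possibly infinite) type. *)
Definition mutually_independent (d : measure_display) (W : measurableType d)
    (R : realType) (P : probability W R) (J : choiceType)
    (F : J -> set_system W) : Prop :=
  forall (S : {fset J}) (E : J -> set W),
    (forall j, j \in S -> F j (E j)) ->
    P (\bigcap_(j in [set` S]) E j) = (\prod_(j <- S) P (E j))%E.

Definition sigma_of (d d' : measure_display) (W : measurableType d)
    (V : measurableType d') (X : W -> V) : set_system W :=
  preimage_set_system setT X measurable.

(* Laws are compared on measurable sets only: the values of a measure outside
   the sigma-algebra are meaningless. *)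
Definition has_law (d d' : measure_display) (W : measurableType d)
    (V : measurableType d') (R : realType) (P : probability W R)
    (X : {RV P >-> V}) (mu : probability V R) : Prop :=
  forall A : set V, measurable A -> distribution P X A = mu A.

Definition rfi (W I G : Type) (T : I -> G -> G) (xi_ : nat -> W -> I)
    (X0 : W -> G) : nat -> W -> G :=
  fix X k := if k is k'.+1 then fun w => T (xi_ k' w) (X k' w) else X0.

Definition as_fixed_points (d : measure_display) (W : measurableType d)
    (R : realType) (P : probability W R) (I G : Type) (T : I -> G -> G)
    (xi : W -> I) : set G :=
  [set x | P [set w | Fix (T (xi w)) x] = 1%E].

(* Main.v *)
From HB Require Import structures.
Require Import Defs.
From mathcomp Require Import all_boot all_order all_algebra finmap.
From mathcomp Require Import all_classical all_reals all_analysis.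
From mathcomp Require Import measurable_realfun.

Set Implicit Arguments.
Unset Strict Implicit.
Unset Printing Implicit Defensive.

Import Order.TTheory GRing.Theory Num.Theory.
Import numFieldNormedType.Exports.

Local Open Scope classical_set_scope.
Local Open Scope ring_scope.

(* Fix a common fixed point [c], i.e. a point of C.  Almost surely d(X_k, c) is
   nonincreasing, so the decrements |d(X_k, c) - d(T_(xi_k) X_k, c)| have a sum
   bounded by the diameter of G.  Since X_k is independent of xi_k, the
   expected decrement is E f(X_k), where f(x) = E |d(x, c) - d(T_xi x, c)|;
   hence the sum of the f(X_k) is almost surely finite and f(X_k) --> 0.  By
   Fatou's lemma f vanishes at every cluster point x of (X_k), and f(x) = 0
   forces T_xi x = x almost surely because T_xi is a paracontraction fixing c.
   So every cluster point is in C, and one exists by compactness.  Finally C is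
   separable, so almost surely d(X_k, y) is nonincreasing for all y in C at
   once; with y a cluster point this gives convergence. *)

(** * Dense sequences and convergence in metric spaces *)

Lemma second_countable_dense_seq (T : topologicalType) (A : set T) :
  @second_countable T -> A !=set0 ->
  exists e : nat -> T, (forall n, A (e n)) /\ A `<=` closure (range e).
Proof.
move=> [B cB [_ Bn]] [a0 Aa0].
(* [f] picks a point of [A] inside each set that meets [A], with [a0] as default otherwise. Its
   values along an enumeration of the countable base form the dense sequence. *)
have /choice[f fP] : forall U : set T, exists a, A a /\ (U `&` A !=set0 -> U a).
  move=> U; have [[a [Ua Aa]]|UA] := pselect (U `&` A !=set0).
    by exists a; split.
  by exists a0.
case/pfcard_geP : cB => [B0|[g]].
  by have [U []] := Bn a0 setT filterT; rewrite B0.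
exists (f \o g); split=> [n|a Aa V /Bn[U [BU Ua] UV]].
  by case: (fP (g n)).
have [n _ gU] := 'surj_g BU; exists (f U).
split; first by exists n; rewrite //= gU.
by apply: UV; apply: (fP U).2; exists a.
Qed.

Section metric.
Context (R : realType) (G : metricType R).
Implicit Types (x y z : G) (u : nat -> G).

Lemma mdist_lipschitz x y z : `|mdist x z - mdist y z| <= mdist x y.
Proof.
rewrite ler_norml lerBlDr metric_triangle andbT lerNl opprB lerBlDr.
by rewrite (metric_sym x y) metric_triangle.
Qed.

Lemma continuous_mdistl y : continuous (fun x => mdist x y).
Proof.
move=> x; apply/cvgrPdist_lt => e e0 /=.
near=> z; apply: le_lt_trans (mdist_lipschitz _ _ _) _.
near: z; have := nbhsx_ballx x e e0; rewrite ballEmdist; exact.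
Unshelve. all: by end_near. Qed.

Lemma metric_closed1 x : closed [set x].
Proof.
by apply: accessible_closed_set1; apply: hausdorff_accessible;
  exact: metric_hausdorff.
Qed.

(** The index [k n] is chosen past [n] with [u (k n)] within 1/(n+1) of [x]. The bound [n <= k n]
    makes [k] tend to infinity, so limits along the whole sequence pass to [u \o k]. *)
Lemma cluster_subseq u x : cluster (u @ \oo) x ->
  exists k : nat -> nat, (forall n, (n <= k n)%N) /\ u (k n) @[n --> \oo] --> x.
Proof.
move=> ux.
have /choice[k kP] n : exists m, (n <= m)%N /\ mdist x (u m) < n.+1%:R^-1.
  have [||y [[m /= nm <-]]] := ux [set u m | m in [set m | (n <= m)%N]]
      (ball x n.+1%:R^-1).
  - by exists n => // m /= nm; exists m.
  - by apply: nbhsx_ballx; rewrite invr_gt0.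
  by rewrite ballEmdist => xu; exists m.
exists k; split=> [n|]; first by have [] := kP n.
apply/metricType_numDomainType.cvgrPdist_lt => e e0; near=> n.
apply: lt_trans (kP n).2 _; near: n; exact: near_infty_natSinv_lt (PosNum e0).
Unshelve. all: by end_near. Qed.

(** Once one term comes within [e] of [x], monotonicity keeps all later terms there. *)
Lemma nonincreasing_mdist_cvg u x :
  (forall k, mdist (u k.+1) x <= mdist (u k) x) -> cluster (u @ \oo) x ->
  u @ \oo --> x.
Proof.
move=> ux /cluster_subseq[k [_ /metricType_numDomainType.cvgrPdist_lt kx]].
apply/metricType_numDomainType.cvgrPdist_lt => e /kx[n _ /(_ n (leqnn _))].
rewrite metric_sym => xe.
exists (k n) => // m /= /subnK <-; rewrite metric_sym.
elim: (m - k n)%N => [//|j ih]; exact: le_lt_trans (ux _) ih.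
Qed.

End metric.

(** * Borel measurability of continuous functions and of pointwise limits *)

Section borel.
Context (d : measure_display) (R : realType) (G : measurableMetricType d R).
Hypothesis borelG : is_borel G.

Lemma borel_open (U : set G) : open U -> measurable U.
Proof. by move=> oU; rewrite borelG; exact: sub_sigma_algebra. Qed.

Lemma borel_closed (A : set G) : closed A -> measurable A.
Proof. by move=> /closed_openC/borel_open/measurableC; rewrite setCK. Qed.

Lemma borel_continuous (f : G -> R) :
  continuous f -> measurable_fun [set: G] f.
Proof.
move=> /continuousP cf; apply: (measurability _ (RGenOpens.measurableE R)).
move=> _ [_ [a [b ->] <-]]; rewrite setTI; apply: borel_open; apply: cf.
exact: interval_open.
Qed.

Lemma borel_measurable_cvg d' (W : measurableType d') (u : nat -> W -> G)
    (v : W -> G) :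
  (forall k, measurable_fun [set: W] (u k)) ->
  (forall w, u ^~ w @ \oo --> v w) -> measurable_fun [set: W] v.
Proof.
move=> mu uv; apply: (measurability _ borelG) => _ [U oU <-]; rewrite setTI.
(* [F n] is closed, and [U] is the union of the interiors of the [F n]. *)
pose F n : set G := \bigcap_(y in ~` U) [set x | n.+1%:R^-1 <= mdist x y].
have cF n : closed (F n).
  apply: (@closed_bigI G G) => y _.
  have cy x : {for x, continuous (@mdist R G ^~ y)} by exact: continuous_mdistl.
  exact: (preimage_closed (fun x _ => cy x) (@closed_ge R n.+1%:R^-1)).
(* [v w] is in [U] iff the [u k w] eventually stay in a single [F n], the set of points at distance
   at least 1/(n+1) from the complement of [U]; closedness lets [F n] retain the limit. *)
have -> : v @^-1` U = \bigcup_n \bigcup_m \bigcap_(k in [set k | (m <= k)%N])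
    (u k @^-1` F n).
  apply/seteqP; split=> [w Uvw|w [n _ [m _ uF]]]; last first.
    have : F n (v w).
      apply: (closed_cvg (F n) (cF n) _ _ (uv w)).
      by exists m => // k mk; exact: uF.
    rewrite /preimage/=; apply: contraPP => nU /(_ _ nU)/=.
    by rewrite mdistxx leNgt invr_gt0 ltr0n.
  have /nbhs_ballP[e /= e0 eU] : nbhs (v w) U by exact: open_nbhs_nbhs.
  have e2 : 0 < e / 2 by rewrite divr_gt0.
  (* Half of the radius [e] pays for the distance from [v w] to [u k w], the other half for the
     margin 1/(n+1). *)
  have [n _ /(_ n (leqnn _)) ne] := near_infty_natSinv_lt (PosNum e2).
  exists n => //.
  have [m _ vu] :=
    (metricType_numDomainType.cvgrPdist_lt _ _).1 (uv w) (e / 2) e2.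
  exists m => // k /vu vk y; apply: contra_notP => /negP; rewrite -ltNge => uy.
  apply: eU; rewrite ballEmdist/=.
  apply: le_lt_trans (metric_triangle _ (u k w) _) _.
  by rewrite [e]splitr ltrD// (lt_trans uy).
apply: bigcupT_measurable => n; apply: bigcupT_measurable => m.
apply: bigcap_measurableType => k _; rewrite -[X in measurable X]setTI.
by apply: mu => //; exact: borel_closed.
Qed.

End borel.

(** * Independence from generators, and joint laws *)

Section independence.
Local Open Scope ereal_scope.
Context (dW : measure_display) (W : measurableType dW) (R : realType).
Context (P : probability W R).

(** Finite measures agreeing on a generating pi-system are equal. Here [m1] is the image under [Z]
    of [P] restricted to [F], and [m2] is the law of [Z] scaled by [P F]. *)
Lemma indep_generated d (V : measurableType d) (Z : W -> V)
    (C : set_system V) (F : set W) :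
  measurable_fun [set: W] Z -> measurable F ->
  @measurable d V = <<s C >> -> setI_closed C -> C [set: V] ->
  (forall A, C A -> P (Z @^-1` A `&` F) = P (Z @^-1` A) * P F) ->
  forall A, measurable A -> P (Z @^-1` A `&` F) = P (Z @^-1` A) * P F.
Proof.
move=> mZ mF mC CI CT indC A mA.
have PF0 : (0 <= fine (P F))%R by rewrite fine_ge0.
pose m1 : {measure set V -> \bar R} := pushforward (mrestr P mF) Z.
pose m2 : {measure set V -> \bar R} := mscale (NngNum PF0) (pushforward P Z).
have m2E B : m2 mZ B = P (Z @^-1` B) * P F.
  by rewrite /m2/= /mscale/= fineK ?fin_num_measure// muleC.
rewrite -m2E.
apply: (@measure_unique _ _ _ C (fun=> setT) _ _ _ _ (m1 mZ) (m2 mZ)) => //.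
- by rewrite bigcup_const//; exists 0%N.
- by move=> B CB; rewrite m2E -indC.
- move=> _; rewrite /m1/= /pushforward preimage_setT /mrestr setTI.
  by rewrite (le_lt_trans (probability_le1 P mF))// ltry.
Qed.

(** Measurable rectangles form a pi-system generating the product sigma-algebra. *)
Lemma indep_pair d1 d2 (V1 : measurableType d1) (V2 : measurableType d2)
    (X : W -> V1) (Y : W -> V2) (F : set W) :
  measurable_fun [set: W] X -> measurable_fun [set: W] Y -> measurable F ->
  (forall A B, measurable A -> measurable B ->
    P (X @^-1` A `&` Y @^-1` B `&` F) = P (X @^-1` A `&` Y @^-1` B) * P F) ->
  forall M : set (V1 * V2), measurable M ->
    P ((fun w => (X w, Y w)) @^-1` M `&` F) =
    P ((fun w => (X w, Y w)) @^-1` M) * P F.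
Proof.
move=> mX mY mF indXY.
apply: (@indep_generated _ _ _
    [set A `*` B | A in @measurable _ V1 & B in @measurable _ V2]) => //.
- exact: measurable_fun_pair.
- exact: measurable_prod_measurableType.
- move=> _ _ [A1 mA1 [B1 mB1 <-]] [A2 mA2 [B2 mB2 <-]].
  exists (A1 `&` A2); first exact: measurableI.
  by exists (B1 `&` B2); [exact: measurableI|rewrite setXI].
- by exists setT => //; exists setT => //; rewrite setXTT.
- by move=> _ [A mA [B mB <-]]; exact: indXY.
Qed.

(** By independence the joint law is the product of the marginals, and Tonelli's theorem applies.
    With [X] the state and [Y] the noise, this averages a step over the noise alone. *)
Lemma joint_law_indep d1 d2 (V1 : measurableType d1) (V2 : measurableType d2)
    (X : {RV P >-> V1}) (Y : {RV P >-> V2}) (nu : probability V2 R)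
    (f : V1 * V2 -> \bar R) :
  measurable_fun [set: V1 * V2] f -> (forall p, 0 <= f p) -> has_law Y nu ->
  (forall A B, measurable A -> measurable B ->
    P (X @^-1` A `&` Y @^-1` B) = P (X @^-1` A) * P (Y @^-1` B)) ->
  \int[P]_w f (X w, Y w) = \int[P]_w \int[nu]_y f (X w, y).
Proof.
move=> mf f0 Ynu indXY.
have mXY : measurable_fun [set: W] (fun w => (X w, Y w)).
  exact: measurable_fun_pair.
pose m : {measure set (V1 * V2) -> \bar R} :=
  pushforward P (fun w => (X w, Y w)).
transitivity (\int[m mXY]_p f p).
  by rewrite ge0_integral_pushforward.
transitivity (\int[distribution P X \x nu]_p f p).
  apply: eq_measure_integral => M mM _.
  apply/esym/product_measure_unique => // A B mA mB.
  transitivity (P (X @^-1` A) * P (Y @^-1` B)); first exact: indXY.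
  by congr (_ * _); exact: Ynu.
rewrite fubini_tonelli1// ge0_integral_distribution//.
- exact: measurable_fun_fubini_tonelli_F.
- by move=> x; exact: integral_ge0.
Qed.

End independence.

(** * Independence of the current state from present and future noise *)

Section iteration.
Local Open Scope ereal_scope.
Context (dG dI dW : measure_display) (G : measurableType dG)
  (I : measurableType dI) (W : measurableType dW) (R : realType).
Context (P : probability W R).

(** This is mutual independence read at the full index set, with [None] (the initial point) split
    off from the noise indices. *)
Lemma mutually_independent_option n (F : option 'I_n -> set_system W)
    (A : set W) (E : 'I_n -> set W) :
  mutually_independent P F -> F None A -> (forall i, F (Some i) (E i)) ->
  P (A `&` \bigcap_i E i) = P A * \prod_(i < n) P (E i).
Proof.
move=> indF FA FE.
pose B (j : option 'I_n) := if j is Some i then E i else A.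
pose S : {fset option 'I_n} := [fset j in enum {: option 'I_n}]%fset.
have SE j : j \in S by rewrite inE mem_enum.
have -> : A `&` \bigcap_i E i = \bigcap_(j in [set` S]) B j.
  apply/seteqP; split => [w [Aw Ew] [i|] _|w BS]//=; first exact: Ew.
  split; first exact: (BS None (SE _)).
  by move=> i _; exact: (BS (Some i) (SE _)).
rewrite indF; last by case.
rewrite (perm_big (None :: map Some (index_enum 'I_n))) ?big_cons ?big_map.
  by [].
apply: uniq_perm => /=; first exact: fset_uniq.
  rewrite map_inj_uniq ?index_enum_uniq ?andbT; last by move=> ? ? [].
  by apply/mapP => -[].
move=> [i|]; rewrite SE inE//=; apply/esym/mapP; exists i => //.
by rewrite mem_index_enum.
Qed.

Context (T : I -> G -> G) (xi_ : nat -> {RV P >-> I}) (X0 : {RV P >-> G}).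
Hypothesis mT : measurable_fun [set: G * I] (fun p : G * I => T p.2 p.1).
Hypothesis indep : forall k : nat,
  mutually_independent P (fun j : option 'I_k.+1 =>
    if j is Some i then sigma_of (xi_ i) else sigma_of X0).

Let X k : W -> G := rfi T xi_ X0 k.

Lemma measurable_rfi k : measurable_fun [set: W] (X k).
Proof.
elim: k => [|k ih]; first exact: measurable_funPT.
apply: (measurableT_comp mT (measurable_fun_pair ih _)).
exact: measurable_funPT.
Qed.

Let measurable_noise k n (E : nat -> set I) :
  (forall j, measurable (E j)) ->
  measurable (\bigcap_(j < n) (xi_ (k + j) @^-1` E j)).
Proof.
move=> mE; apply: bigcap_measurableType => j _.
exact: measurable_funPTI.
Qed.

(** Only [n = 1] is used later, but the induction on [k] needs blocks of every length: [X k.+1] is a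
    function of [X k] and [xi_ k], so a block of length [n] after it calls for one of length [n.+1]
    after [X k]. *)
Lemma rfi_indep_noise k n (A : set G) (E : nat -> set I) :
  measurable A -> (forall j, measurable (E j)) ->
  P (X k @^-1` A `&` \bigcap_(j < n) (xi_ (k + j) @^-1` E j)) =
  P (X k @^-1` A) * \prod_(j < n) P (xi_ (k + j) @^-1` E j).
Proof.
elim: k n A E => [|k ih] n A E mA mE.
  (* [indep] speaks of at least one [xi_ i], hence the trivial event added at
     index [n]. *)
  pose E' j := if (j < n)%N then E j else setT.
  have := @mutually_independent_option n.+1 _ (X0 @^-1` A)
    (fun i => xi_ i @^-1` E' i) (@indep n).
  have E'n : E' n = setT by rewrite /E' ltnn.
  rewrite big_ord_recr/= E'n preimage_setT probability_setT mule1.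
  under eq_bigr => i _ do rewrite /E' ltn_ord.
  move=> <-; last 2 first.
  - by exists A => //; rewrite setTI.
  - move=> i; exists (E' i); last by rewrite setTI.
    by rewrite /E'; case: ifPn.
  congr (P (_ `&` _)); apply/seteqP; split => w Ew i.
    by rewrite /E' => _; case: ifPn => // /Ew.
  by move=> /= i_n; have := Ew (Ordinal (ltnW i_n : (i < n.+1)%N)) Logic.I;
    rewrite /E'/= i_n.
pose F := \bigcap_(j < n) (xi_ (k.+1 + j) @^-1` E j).
(* The induction hypothesis is taken for the block [E'] of length [n.+1], which is [E] with [C] put
   in front. *)
have step B C : measurable B -> measurable C ->
    P (X k @^-1` B `&` xi_ k @^-1` C `&` F) =
    P (X k @^-1` B) * P (xi_ k @^-1` C) *
      \prod_(j < n) P (xi_ (k.+1 + j) @^-1` E j).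
  move=> mB mC; pose E' j := if j is j'.+1 then E j' else C.
  have mE' j : measurable (E' j) by case: j.
  have bumpE (i : 'I_n) : (k + bump 0 i = k.+1 + i)%N.
    by rewrite /bump/= add1n addnS addSn.
  rewrite /F bigcap_mkord; have := ih n.+1 B E' mB mE'.
  rewrite bigcap_mkord !big_ord_recl/= addn0 muleA setIA.
  under eq_bigr do rewrite bumpE.
  by under [in X in _ = X -> _]eq_bigr do rewrite bumpE.
have PF : P F = \prod_(j < n) P (xi_ (k.+1 + j) @^-1` E j).
  have := step setT setT measurableT measurableT.
  by rewrite !preimage_setT !setTI probability_setT !mul1e.
have indXxi B C : measurable B -> measurable C ->
    P (X k @^-1` B `&` xi_ k @^-1` C) = P (X k @^-1` B) * P (xi_ k @^-1` C).
  move=> mB mC; have := ih 1%N B (fun=> C) mB (fun=> mC).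
  by rewrite bigcap_mkord !big_ord1 addn0.
(* [X k.+1] lies in [A] exactly when the pair of [X k] and [xi_ k] lies in [M], which need not be a
   rectangle; hence [indep_pair]. *)
rewrite -PF; pose M : set (G * I) := (fun p => T p.2 p.1) @^-1` A.
apply: (@indep_pair _ _ _ P _ _ _ _ (X k) (xi_ k) F _ _ _ _ M).
- exact: measurable_rfi.
- exact: measurable_funPT.
- exact: measurable_noise.
- by move=> B C mB mC; rewrite step// indXxi// PF.
- by rewrite -[X in measurable X]setTI; exact: mT.
Qed.

Lemma rfi_indep_next k (A : set G) (B : set I) : measurable A -> measurable B ->
  P (X k @^-1` A `&` xi_ k @^-1` B) = P (X k @^-1` A) * P (xi_ k @^-1` B).
Proof.
move=> mA mB; have := @rfi_indep_noise k 1 A (fun=> B) mA (fun=> mB).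
by rewrite bigcap_mkord !big_ord1 addn0.
Qed.

End iteration.

(** * Paracontractions and their fixed points *)

Section paracontraction.
Context (R : realType) (G : metricType R) (g : G -> G).
Hypothesis pg : paracontractive g.

Lemma paracontractive_le x y : g y = y -> mdist (g x) y <= mdist x y.
Proof.
move=> gy; have [->//|gx] := pselect (g x = x).
by apply/ltW; exact: pg.2.
Qed.

Lemma paracontractive_fix x y :
  g y = y -> mdist x y <= mdist (g x) y -> g x = x.
Proof.
by move=> gy xy; apply: contrapT => gx; move: xy; rewrite leNgt pg.2.
Qed.

(** For [y] in [D] near [x], d(g x, x) <= d(g x, y) + d(y, x) <= 2 d(x, y). This extends fixedness
    from a countable dense subset to all of C. *)
Lemma paracontractive_closure_fix (D : set G) x :
  (forall y, D y -> g y = y) -> closure D x -> g x = x.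
Proof.
move=> gD Dx; apply: mdist_positivity; apply/eqP; rewrite eq_le mdist_ge0 andbT.
apply/ler_addgt0Pl => e e0; rewrite addr0.
have [y [/gD gy]] := Dx _ (nbhsx_ballx x (e / 2) (divr_gt0 e0 (ltr0n _ 2))).
rewrite ballEmdist/= => xy; apply: le_trans (metric_triangle _ y _) _.
rewrite [e]splitr lerD//; last by rewrite metric_sym ltW.
by rewrite (le_trans (paracontractive_le x gy))// ltW.
Qed.

End paracontraction.

(** * The expected decrement of the distance to [c] *)

Lemma ae_prob1 d (W : measurableType d) (R : realType) (P : probability W R)
    (A : set W) : measurable A ->
  P A = 1%E <-> {ae P, forall w, A w}.
Proof.
move=> mA; split=> [PA|/(measure_negligible (measurableC mA))].
  by exists (~` A); split => //; [exact: measurableC|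
    rewrite probability_setC// PA subee].
by rewrite -[X in P X = 1%E]setCK [in X in _ -> X]probability_setC;
  [move=> ->; rewrite sube0|exact: measurableC].
Qed.

Section drift.
Local Open Scope ereal_scope.
Context (R : realType) (dG dI dW : measure_display).
Context (G : measurableMetricType dG R) (I : measurableType dI)
  (W : measurableType dW) (P : probability W R).
Context (T : I -> G -> G) (xi : {RV P >-> I}).
Hypothesis borelG : is_borel G.
Hypothesis mT : measurable_fun [set: G * I] (fun p : G * I => T p.2 p.1).
Hypothesis pT : forall i, paracontractive (T i).

Let C := as_fixed_points P T xi.

Lemma measurable_Fix x : measurable [set i | Fix (T i) x].
Proof.
have m1 : measurable [set x] by exact/(borel_closed borelG)/metric_closed1.
by have := measurable_fun_pair2 x mT measurableT m1; rewrite setTI.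
Qed.

(** Membership in [C] depends only on the law of [xi], so it can be tested on any copy [xi_ k]. *)
Lemma as_fixed_points_ae x (eta : {RV P >-> I}) :
  has_law eta (distribution P xi) ->
  C x <-> {ae P, forall w, T (eta w) x = x}.
Proof.
move=> eta_xi; have mF := measurable_Fix x.
rewrite -ae_prob1; last exact: (measurable_funPTI eta mF).
by rewrite -[X in X = 1]/(distribution P eta [set i | Fix (T i) x]) eta_xi.
Qed.

Variable c : G.
Hypothesis Cc : C c.

(** The absolute value keeps [h] nonnegative even where [T i] moves [c], so Tonelli and Fatou apply
    without exceptional sets. *)
Let h (p : G * I) : \bar R :=
  `|mdist p.1 c - mdist (T p.2 p.1) c|%:E.

Let h_ge0 p : 0 <= h p.
Proof. by rewrite lee_fin. Qed.

Let measurable_h : measurable_fun [set: G * I] h.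
Proof.
have md : measurable_fun [set: G] (mdist^~ c).
  exact: (borel_continuous borelG (@continuous_mdistl _ _ c)).
apply/measurable_EFinP; apply: measurableT_comp => //; apply: measurable_funB.
  exact: (measurableT_comp md measurable_fst).
exact: (measurableT_comp md mT).
Qed.

Definition drift x : \bar R := \int[distribution P xi]_i h (x, i).

Lemma drift_ge0 x : 0 <= drift x.
Proof. exact: integral_ge0. Qed.

Lemma measurable_drift : measurable_fun [set: G] drift.
Proof. exact: measurable_fun_fubini_tonelli_F. Qed.

Lemma drift_eq0 x : drift x = 0 -> C x.
Proof.
move=> d0; apply/(as_fixed_points_ae x (eta := xi)) => //.
have mhx : measurable_fun [set: W] (fun w => h (x, xi w)).
  apply: (measurableT_comp measurable_h); apply: measurable_fun_pair => //.
have : \int[P]_w `|h (x, xi w)| = 0.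
  under eq_integral do rewrite gee0_abs//.
  rewrite -d0 /drift ge0_integral_distribution//.
  exact: measurable_fun_pair2.
move=> /ae_eq_integral_abs -/(_ measurableT mhx).
move/(as_fixed_points_ae c (eta := xi)) : Cc => /(_ (fun _ _ => erefl)).
apply: filterS2 => w Tc /(_ Logic.I)[] h0.
apply: (paracontractive_fix (pT _) Tc); rewrite -subr_le0.
by rewrite (normr0_eq0 h0).
Qed.

Lemma drift_cvg0 (u : nat -> G) x :
  u @ \oo --> x -> drift (u n) @[n --> \oo] --> 0 -> drift x = 0.
Proof.
move=> ux du; apply/eqP; rewrite eq_le drift_ge0 andbT.
have hcvg i : h (u n, i) @[n --> \oo] --> h (x, i).
  have cd := @continuous_mdistl _ _ c.
  apply: cvg_EFin; first exact: nearW.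
  apply: cvg_norm; apply: cvgB; first exact: (cvg_comp _ _ ux (cd x)).
  exact: (cvg_comp _ _ (cvg_comp _ _ ux ((pT i).1 x)) (cd (T i x))).
(* Pointwise convergence turns the integrand into a lower limit, the form required by Fatou's
   lemma. *)
have -> : drift x = \int[distribution P xi]_i limn_einf (fun n => h (u n, i)).
  apply: eq_integral => i _; rewrite is_cvg_limn_einfE.
    by apply/esym/cvg_lim => //; exact: hcvg.
  by apply/cvg_ex; exists (h (x, i)); exact: hcvg.
rewrite -(cvg_lim _ du)// -is_cvg_limn_einfE; last by apply/cvg_ex; exists 0.
apply: fatou => // n.
exact: measurable_fun_pair2.
Qed.

Variables (xi_ : nat -> {RV P >-> I}) (X0 : {RV P >-> G}).
Hypothesis xi_law : forall k, has_law (xi_ k) (distribution P xi).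
Hypothesis indep : forall k : nat,
  mutually_independent P (fun j : option 'I_k.+1 =>
    if j is Some i then sigma_of (xi_ i) else sigma_of X0).
Hypothesis cptG : compact [set: G].

Let X k : W -> G := rfi T xi_ X0 k.

Lemma as_fixed_points_ae_all x :
  C x -> {ae P, forall w, forall k, T (xi_ k w) x = x}.
Proof.
by move=> Cx; apply: ae_foralln => k; apply/(as_fixed_points_ae x (xi_law k)).
Qed.

Let mX k : measurable_fun [set: W] (X k).
Proof. exact: measurable_rfi. Qed.

Let measurable_step k : measurable_fun [set: W] (fun w => h (X k w, xi_ k w)).
Proof.
by apply: (measurableT_comp measurable_h); exact: measurable_fun_pair.
Qed.

(* [h] telescopes along the iteration because the distance to [c] decreases. *)
Lemma integral_sum_drift_lty :
  \int[P]_w (\sum_(k <oo) drift (X k w)) < +oo.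
Proof.
have [M dM] : exists M : R, forall x, (mdist x c <= M)%R.
  (* Boundedness only provides bounds strictly above [M], hence the witness [M + 1]. *)
  have /compact_bounded[M [_ /(_ (M + 1)%R)]] : compact (mdist^~ c @` [set: G]).
    apply: continuous_compact => //; apply: continuous_subspaceT.
    exact: continuous_mdistl.
  rewrite ltrDl ltr01 => /(_ isT) dM; exists (M + 1)%R => x.
  by rewrite (le_trans (ler_norm _))//; apply: dM; exists x.
rewrite integral_nneseries//; last 2 first.
- by move=> k; exact: measurableT_comp measurable_drift (mX k).
- by move=> k w _; exact: drift_ge0.
(* Independence of [X k] and [xi_ k] trades the averaged decrement for the actual one, whose sum is
   bounded path by path. *)
have driftE k : \int[P]_w drift (X k w) = \int[P]_w h (X k w, xi_ k w).
  pose Xk : {mfun W >-> G} :=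
    HB.pack (X k) (isMeasurableFun.Build _ _ _ _ _ (mX k)).
  apply/esym; apply: (@joint_law_indep _ _ _ P _ _ _ _ Xk (xi_ k)) => //.
  by move=> A B; exact: rfi_indep_next.
under eq_eseriesr do rewrite driftE.
rewrite -integral_nneseries//.
apply: (@le_lt_trans _ _ (\int[P]_w M%:E)); last first.
  rewrite (integral_cst _ measurableT).
  by rewrite [X in _ * X]probability_setT mule1 ltry.
apply: ae_ge0_le_integral => //.
- by move=> w _; exact: nneseries_ge0.
- exact: ge0_emeasurable_sum.
- by move=> w _; rewrite lee_fin (le_trans _ (dM c))// mdist_ge0.
have := as_fixed_points_ae_all Cc; apply: filterS => w Tc _.
apply: lime_le; first by apply: is_cvg_nneseries => n _ _; exact: h_ge0.
apply: nearW => n; rewrite sumEFin lee_fin.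
(* Where all [T (xi_ k w)] fix [c], the absolute values open with a known sign and the partial sum
   is d(X_0, c) - d(X_n, c), at most [M]. *)
rewrite (eq_bigr (fun k => - (mdist (X k.+1 w) c - mdist (X k w) c)))%R.
  rewrite sumrN telescope_sumr// opprB lerBlDr (le_trans (dM _))//.
  by rewrite lerDl mdist_ge0.
move=> k _; rewrite opprB ger0_norm// subr_ge0.
by apply: paracontractive_le => //; exact: Tc.
Qed.

(** A nonnegative series with finite expectation is almost surely finite, and its [N]-th term is
    squeezed between 0 and the tail starting at [N]. *)
Lemma drift_rfi_cvg0 : {ae P, forall w, drift (X k w) @[k --> \oo] --> 0}.
Proof.
have mS : measurable_fun [set: W] (fun w => \sum_(k <oo) drift (X k w)).
  apply: ge0_emeasurable_sum => [k w _ _|k _]; first exact: drift_ge0.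
  exact: measurableT_comp measurable_drift (mX k).
have S0 w : 0 <= \sum_(k <oo) drift (X k w).
  by apply: nneseries_ge0 => k _ _; exact: drift_ge0.
have intS : P.-integrable setT (fun w => \sum_(k <oo) drift (X k w)).
  apply/integrableP; split=> //; under eq_integral do rewrite gee0_abs//.
  exact: integral_sum_drift_lty.
have := integrable_ae measurableT intS; apply: filterS => w /(_ Logic.I) Sfin.
apply: (@squeeze_cvge _ _ _ _ (cst 0) _
    (fun N => \sum_(N <= k <oo) drift (X k w))); last 2 first.
- exact: cvg_cst.
- apply: (@nneseries_tail_cvg _ _ xpredT) => [|k _]; last exact: drift_ge0.
  by rewrite ltey_eq Sfin.
apply: nearW => N; rewrite drift_ge0/=.
have := @nneseries_lim_ge _ (fun k => drift (X k w)) xpredT N N.+1.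
by rewrite big_nat1; apply => k _ _; exact: drift_ge0.
Qed.

End drift.

(** * The limit as a random variable, and the convergence theorem *)

Lemma ae_cvg_measurable_limit (R : realType) (dG dW : measure_display)
    (G : measurableMetricType dG R) (W : measurableType dW)
    (P : probability W R) (C : set G) (X : nat -> W -> G) :
  is_borel G -> C !=set0 -> (forall k, measurable_fun [set: W] (X k)) ->
  {ae P, forall w, exists2 x, C x & X ^~ w @ \oo --> x} ->
  exists Y : {RV P >-> G}, (forall w, C (Y w)) /\
    {ae P, forall w, X ^~ w @ \oo --> Y w}.
Proof.
move=> borelG [c Cc] mX [N [mN PN XN]].
(* Freezing the sequence at [c] on the measurable null set [N] makes it converge everywhere with
   limit in [C], so the limit is measurable as a pointwise limit. *)
pose Z k w := if w \in N then c else X k w.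
have mZ k : measurable_fun [set: W] (Z k).
  apply: measurable_fun_ifT; [|exact: measurable_cst|exact: mX].
  by apply: (measurable_fun_bool true); rewrite setTI preimage_mem_true.
have /choice[Y YP] : forall w, exists x, C x /\ Z ^~ w @ \oo --> x.
  move=> w; have [Nw|Nw] := boolP (w \in N).
    by exists c; split=> //; rewrite /Z Nw; exact: cvg_cst.
  have [x Cx Xx] : exists2 x, C x & X ^~ w @ \oo --> x.
    by apply: contrapT => /XN /mem_set; rewrite (negbTE Nw).
  by exists x; split=> //; rewrite /Z (negbTE Nw).
have mY : measurable_fun [set: W] Y.
  by apply: (borel_measurable_cvg borelG mZ) => w; exact: (YP w).2.
exists (HB.pack Y (isMeasurableFun.Build _ _ _ _ _ mY) : {mfun W >-> G}).
split=> [w|]; first exact: (YP w).1.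
exists N; split=> // w /=; apply: contra_notP => Nw.
by have := (YP w).2; rewrite /Z/= (memNset Nw).
Qed.

Theorem theorem3p5 (R : realType)
  (dG dI dW : measure_display)
  (G : measurableMetricType dG R) (I : measurableType dI)
  (W : measurableType dW) (P : probability W R)
  (T : I -> G -> G)
  (xi : {RV P >-> I}) (xi_ : nat -> {RV P >-> I})
  (mu : probability G R) (X0 : {RV P >-> G}) :
  is_borel G ->
  measurable_fun [set: G * I] (fun p : G * I => T p.2 p.1) ->
  mutually_independent P (fun k : nat => sigma_of (xi_ k)) ->
  (forall k : nat, has_law (xi_ k) (distribution P xi)) ->
  has_law X0 mu ->
  (forall k : nat, mutually_independent P (fun j : option 'I_k.+1 =>
     if j is Some i then sigma_of (xi_ i) else sigma_of X0)) ->
  compact [set: G] ->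
  (forall i : I, paracontractive (T i)) ->
  as_fixed_points P T xi !=set0 ->
  exists Xmu : {RV P >-> G},
    (forall w : W, as_fixed_points P T xi (Xmu w)) /\
    {ae P, forall w : W, (fun k : nat => rfi T xi_ X0 k w) @ \oo --> Xmu w}.
Proof.
move=> borelG mT _ xi_law _ indep cptG pT C0; have [c Cc] := C0.
apply: ae_cvg_measurable_limit => //.
  by move=> k; exact: measurable_rfi.
have [e [Ce eC]] :=
  second_countable_dense_seq (compact_second_countable cptG) C0.
(* Only countably many pairs [(n, k)] occur, so a single null set covers all exceptions. *)
have Te : {ae P, forall w, forall n k, T (xi_ k w) (e n) = e n}.
  apply: ae_foralln => n.
  exact: (as_fixed_points_ae_all borelG mT xi_law (Ce n)).
have := drift_rfi_cvg0 borelG mT pT Cc xi_law indep cptG.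
apply: filterS2 Te => w Te dX; set X := fun k => rfi T xi_ X0 k w.
(* The null set no longer depends on [x]; this matters because the cluster point taken below depends
   on [w]. *)
have TC k x : as_fixed_points P T xi x -> T (xi_ k w) x = x.
  move=> /eC; apply: paracontractive_closure_fix => // _ [n _ <-].
  exact: Te.
have [x [_ Xx]] := cptG (X @ \oo) _ filterT.
have [m [nm Xmx]] := cluster_subseq Xx.
have moo : m @ \oo --> \oo.
  by apply/cvgnyPge => A; exists A => // n /= An; exact: leq_trans (nm n).
have Cx : as_fixed_points P T xi x.
  apply: (drift_eq0 borelG mT pT Cc).
  apply: (drift_cvg0 borelG mT pT Xmx).
  exact: (cvg_comp _ _ moo dX).
exists x => //; apply: nonincreasing_mdist_cvg => // k.
by apply: paracontractive_le => //; exact: TC.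
Qed.
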